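(* The joint spectral radius $\mu:\beta\to\mathbb{R}_+$, $\Psi\mapsto\mu(\Psi)$, is locally Lipschitz continuous on $\beta$ with respect to the Hausdorff metric, where $\beta$ is the collection of all compact (nonempty) subsets $\Psi$ of $\mathbb{R}^{n\times n}_+$ such that the semigroup $\mathcal{S}(\Psi)$ is irreducible.
   Context: $\mathbb{R}^{n\times n}_+$ is the set of $n\times n$ matrices with nonnegative real entries. Max-algebraic operations: $a\oplus b=\max\{a,b\}$ and $a\otimes b=ab$ on $\mathbb{R}_+$, extended to matrices by $(A\otimes B)_{ij}=\max_k a_{ik}b_{kj}$, with $A\oplus B$ the entrywise maximum. For $A\in\mathbb{R}^{n\times n}_+$, $\mu(A)=\max\{(a_{i_1i_2}a_{i_2i_3}\cdots a_{i_ki_1})^{1/k} \mid k\ge 1,\ 1\le i_1,\dots,i_k\le n \text{ distinct}\}$. For a bounded set $\Psi\subseteq\mathbb{R}^{n\times n}_+$ and $m\ge1$, $\Psi^m_\otimes=\{A_1\otimes\cdots\otimes A_m\mid A_j\in\Psi\}$, and $\Psi^0_\otimes=\{I\}$. The max-algebraic joint spectral radius is $\mu(\Psi)=\limsup_{m\to\infty}\left(\sup_{A\in\Psi^m_\otimes}\mu(A)\right)^{1/m}$, and the semigroup of $\Psi$ is $\mathcal{S}(\Psi)=\bigcup_{m\ge0}\Psi^m_\otimes$. The max-convex hull of a set $M$ is $\mathrm{conv}_\otimes(M)=\{\bigoplus_{i=1}^k\alpha_ix_i\mid k\in\mathbb{N},\ x_i\in M,\ \alpha_i\ge0,\ \bigoplus_{i=1}^k\alpha_i=1\}$.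 A matrix $A$ is irreducible if there is no nonempty proper subset $I\subset\{1,\dots,n\}$ with $a_{ij}=0$ for all $i\in I$, $j\notin I$. The semigroup $\mathcal{S}(\Psi)$ is irreducible if $\mathrm{conv}_\otimes(\Psi^m_\otimes)$ contains an irreducible matrix for some $m\ge0$. The Hausdorff metric on $\beta$ is $\mathcal{H}(\Psi,\Phi)=\max\{\max_{A\in\Psi}\mathrm{dist}(A,\Phi),\ \max_{B\in\Phi}\mathrm{dist}(B,\Psi)\}$ with $\mathrm{dist}(A,\Phi)=\min_{B\in\Phi}\|A-B\|$, where $\|\cdot\|$ is the (conventional) matrix norm induced by the norm $\|\cdot\|_\infty$ on $\mathbb{R}^n$. *)

(* Defs.v *)
From mathcomp Require Import all_boot all_order all_algebra.
From mathcomp Require Import all_classical all_reals all_analysis.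

Set Implicit Arguments.
Unset Strict Implicit.
Unset Printing Implicit Defensive.

Import Order.TTheory GRing.Theory Num.Theory.
Import numFieldNormedType.Exports.

Local Open Scope classical_set_scope.
Local Open Scope ring_scope.

Section MaxAlgebra.
Context {R : realType} {n : nat}.
Implicit Types (A B : 'M[R]_n) (M Psi Phi : set 'M[R]_n).

Definition nonneg_mx A : Prop := forall i j, 0 <= A i j.

(* The max-algebraic operations are meant for nonnegative matrices only, so
   that 0 is neutral for the maximum. *)
Definition max_addmx A B : 'M[R]_n := \matrix_(i, j) Num.max (A i j) (B i j).

Definition max_mulmx A B : 'M[R]_n :=
  \matrix_(i, j) \big[Num.max/0]_(k < n) (A i k * B k j).

(* Cycles of length k+1 with pairwise distinct vertices are the injective maps
   c from 'I_k.+1 to 'I_n; ordS is the cyclic successor on 'I_k.+1. *)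
Definition max_cycle_mean A : R :=
  \big[Num.max/0]_(k < n)
    \big[Num.max/0]_(c : {ffun 'I_k.+1 -> 'I_n} | injectiveb c)
      ((\prod_(j < k.+1) A (c j) (c (ordS j))) `^ (k.+1%:R^-1)).

Definition max_power Psi (m : nat) : set 'M[R]_n :=
  [set \big[max_mulmx/1%:M]_(j < m) A j
    | A in [set A : 'I_m -> 'M[R]_n | forall j, Psi (A j)]].

(* For nonempty bounded Psi the suprema are finite and the sequence is bounded,
   so the real-valued sup and limn_sup are the genuine ones. *)
Definition max_jsr Psi : R :=
  limn_sup (fun m : nat =>
    (sup [set max_cycle_mean A | A in max_power Psi m]) `^ (m%:R^-1)).

Definition max_conv M : set 'M[R]_n :=
  [set A | exists (k : nat) (a : 'I_k -> R) (x : 'I_k -> 'M[R]_n),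
    [/\ forall i, M (x i), forall i, 0 <= a i,
        \big[Num.max/0]_(i < k) a i = 1
      & A = \big[max_addmx/0]_(i < k) (a i *: x i)]].

Definition irreducible_mx A : Prop :=
  ~ exists I : {set 'I_n},
      [/\ I != finset.set0, I \proper [set: 'I_n]%SET
        & forall i j, i \in I -> j \notin I -> A i j = 0].

(* Irreducibility of the semigroup generated by Psi. *)
Definition irreducible_semigroup Psi : Prop :=
  exists m A, max_conv (max_power Psi m) A /\ irreducible_mx A.

Definition compact_irreducible : set (set 'M[R]_n) :=
  [set Psi | [/\ Psi !=set0, compact Psi, Psi `<=` nonneg_mx
               & irreducible_semigroup Psi]].

(* The library norm on column vectors is the maximum norm. *)
Definition induced_norm A : R :=
  sup [set `|A *m x| | x in [set x : 'cV[R]_n | `|x| <= 1]].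

Definition set_dist A Phi : R := inf [set induced_norm (A - B) | B in Phi].

(* Extrema over compact sets are attained, so sup and inf are max and min. *)
Definition hausdorff_dist Psi Phi : R :=
  Num.max (sup [set set_dist A Phi | A in Psi])
          (sup [set set_dist B Psi | B in Phi]).

End MaxAlgebra.

(* Local Lipschitz continuity on X for a distance d on X. *)
Definition locally_lipschitz_on {R : realType} {T : Type}
    (X : set T) (d : T -> T -> R) (f : T -> R) : Prop :=
  forall x, X x -> exists r L : R, [/\ 0 < r, 0 <= L
    & forall y z, X y -> X z -> d x y < r -> d x z < r ->
        `|f y - f z| <= L * d y z].

(* Main.v *)
Require Import Defs.
From mathcomp Require Import all_boot all_order all_algebra.
From mathcomp Require Import all_classical all_reals all_analysis.
From mathcomp Require Import zify lra.

Set Implicit Arguments.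
Unset Strict Implicit.
Unset Printing Implicit Defensive.

Import Order.TTheory GRing.Theory Num.Theory.
Import numFieldNormedType.Exports.

Local Open Scope classical_set_scope.
Local Open Scope ring_scope.

(* For compact Psi, the joint spectral radius is the maximal cycle mean of the
   entrywise supremum S of Psi: in a closed walk the factors of Psi may be chosen
   independently at each step, so the best closed walk of length m through
   products of Psi is the best closed walk of length m in S, and every closed
   walk splits into simple cycles.  The map from Psi to S is 1-Lipschitz
   entrywise, so it remains to treat the cycle mean of a single matrix.  There,
   if mu(S) >= c > 0 and the entries of S are at most M, every edge of an optimal
   simple cycle has weight at least e = M (c / M)^n; perturbing the entries by d
   shrinks each edge by a factor at least 1 - d / e, hence mu(S) by at most
   M d / e.  Irreducibility gives a positive cycle when n > 1; for n = 1 the cycle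
   mean is the single entry. *)

(** * Repetitions in lists and integer roots *)

Lemma nuniq_split (T : eqType) (s : seq T) : ~~ uniq s ->
  exists y s1 s2 s3, s = s1 ++ y :: s2 ++ y :: s3.
Proof.
elim: s => [//|a s IHs] /=; rewrite negb_and negbK => /orP[a_s|/IHs].
  by case/splitPr: s / a_s {IHs} => s1 s2; exists a, [::], s1, s2.
by move=> [y [s1 [s2 [s3 ->]]]]; exists y, (a :: s1), s2, s3.
Qed.

Lemma powR_invnK (R : realType) (a : R) k : 0 <= a -> (0 < k)%N ->
  (a `^ k%:R^-1) ^+ k = a.
Proof.
move=> a0 k0; rewrite -powR_mulrn ?powR_ge0// -powRrM mulVf ?powRr1//.
by rewrite pnatr_eq0 -lt0n.
Qed.

(** * Closed walks and the maximal cycle mean *)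

Section Walks.
Context {R : realType} {n : nat}.
Implicit Types (A B : 'M[R]_n) (x y : 'I_n) (s t : seq 'I_n).

(** The starting vertex [x] is kept apart from the list [s] of later vertices, so [size s] counts
    edges and the walk is closed when [last x s = x]. *)
Fixpoint walk_weight A x s : R :=
  if s is y :: s' then A x y * walk_weight A y s' else 1.

Lemma walk_weight_cat A x s t :
  walk_weight A x (s ++ t) = walk_weight A x s * walk_weight A (last x s) t.
Proof. by elim: s x => [|y s IHs] x /=; rewrite ?mul1r// IHs mulrA. Qed.

Lemma walk_weight_ge0 A x s : nonneg_mx A -> 0 <= walk_weight A x s.
Proof.
by move=> A0; elim: s x => [|y s IHs] x //=; rewrite mulr_ge0 ?A0 ?IHs.
Qed.

Lemma walk_weight_nth A x s :
  walk_weight A x s = \prod_(i < size s) A (nth x (x :: s) i) (nth x s i).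
Proof.
elim: s x => [|y s IHs] x /=; first by rewrite big_ord0.
rewrite big_ord_recl IHs /=; congr (_ * _); apply: eq_bigr => i _.
have lt_is := ltn_ord i.
by rewrite !(set_nth_default y x)//= ltnW.
Qed.

(** Starting at [c ord_max], the cyclic predecessor of [c ord0], makes the later vertices exactly
    the values of [c] in order. *)
Lemma walk_weight_cycle A k (c : 'I_k.+1 -> 'I_n) :
  \prod_(j < k.+1) A (c j) (c (ordS j)) =
  walk_weight A (c ord_max) [seq c j | j <- enum 'I_k.+1].
Proof.
rewrite (reindex_inj (@ord_pred_inj k.+1)) walk_weight_nth size_map size_enum_ord.
apply: eq_bigr => i _; rewrite ord_predK.
rewrite (nth_map ord0) ?size_enum_ord// nth_ord_enum; congr (A _ _).
case: i => [[|i] /= lt_ik].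
  congr c; apply: val_inj => /=.
  by rewrite modn_small.
rewrite (nth_map ord0) ?size_enum_ord 1?ltnW//; congr c; apply: val_inj => /=.
by rewrite nth_enum_ord 1?ltnW// modnDr modn_small // ltnW.
Qed.

(** Cutting out the loop between two visits to the same vertex leaves two shorter closed walks whose
    weights multiply to the original one. *)
Lemma walk_weight_le_pow A b x s : nonneg_mx A -> 0 <= b ->
  (forall y t, uniq t -> last y t = y -> walk_weight A y t <= b ^+ size t) ->
  last x s = x -> walk_weight A x s <= b ^+ size s.
Proof.
move=> A0 b0 Hb; have [m] := ubnP (size s).
elim: m x s => [//|m IHm] x s lt_sm s_x.
have [us|/nuniq_split[y [s1 [s2 [s3 sE]]]]] := boolP (uniq s); first exact: Hb.
move: lt_sm s_x; rewrite {}sE => lt_sm s_x.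
have -> : walk_weight A x (s1 ++ y :: s2 ++ y :: s3) =
  walk_weight A x (s1 ++ y :: s3) * walk_weight A y (rcons s2 y).
  rewrite -cats1 !(walk_weight_cat, last_cat) /= !(walk_weight_cat, last_cat).
  by rewrite /= mulr1 -!mulrA; congr (_ * (_ * _)); rewrite mulrA mulrC.
have -> : size (s1 ++ y :: s2 ++ y :: s3) =
  (size (s1 ++ y :: s3) + size (rcons s2 y))%N.
  by rewrite !size_cat /= size_cat size_rcons /= !addnS addSn addnA addnAC.
rewrite exprD ler_pM ?walk_weight_ge0//; apply: IHm.
- by move: lt_sm; rewrite !size_cat /= size_cat /= !ltnS !addnS; lia.
- by move: s_x; rewrite !last_cat /= last_cat.
- by move: lt_sm; rewrite !size_cat size_rcons /= size_cat /= !ltnS !addnS; lia.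
- by rewrite last_rcons.
Qed.

Lemma max_cycle_mean_ge0 A : 0 <= max_cycle_mean A.
Proof. exact: bigmax_ge_id. Qed.

Lemma cycle_le_max_cycle_mean A x s : nonneg_mx A -> uniq s -> last x s = x ->
  walk_weight A x s <= max_cycle_mean A ^+ size s.
Proof.
move=> A0 us s_x; case: s us s_x => [//|y s] us s_x.
have lt_sn : (size s < n)%N.
  by have := uniq_leq_size us (fun z _ => mem_enum 'I_n z); rewrite size_enum_ord.
pose c := [ffun i : 'I_(size s).+1 => nth x (y :: s) i].
have c_inj : injectiveb c.
  apply/injectiveP => i j; rewrite !ffunE => /eqP.
  by rewrite nth_uniq// => /eqP/val_inj.
have cE : [seq c j | j <- enum 'I_(size s).+1] = y :: s.
  apply: (@eq_from_nth _ x); first by rewrite size_map size_enum_ord.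
  move=> i; rewrite size_map size_enum_ord => lt_is.
  by rewrite (nth_map ord0) ?size_enum_ord// ffunE nth_enum_ord.
have cmax : c ord_max = x by rewrite ffunE (last_nth x) in s_x *.
have := walk_weight_cycle A c; rewrite cE cmax => /esym wE.
have w0 := walk_weight_ge0 x (y :: s) A0.
have : walk_weight A x (y :: s) `^ (size s).+1%:R^-1 <= max_cycle_mean A.
  apply: (bigmax_sup (Ordinal lt_sn)) => //.
  by apply: (bigmax_sup c) => //; rewrite wE.
move=> /(lerXn2r (size s).+1); rewrite !nnegrE powR_ge0 max_cycle_mean_ge0.
by move=> /(_ isT isT); rewrite powR_invnK.
Qed.

Lemma closed_walk_le A x s : nonneg_mx A -> last x s = x ->
  walk_weight A x s <= max_cycle_mean A ^+ size s.
Proof.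
move=> A0; apply: walk_weight_le_pow (max_cycle_mean_ge0 A) _ => //.
by move=> y t; apply: cycle_le_max_cycle_mean.
Qed.

Lemma max_cycle_mean_attained A : (0 < n)%N -> nonneg_mx A ->
  (* If the mean is 0, it may be only the default value of the maximum; any loop then serves, its
     weight being squeezed to 0. *)
  exists x s, [/\ (0 < size s <= n)%N, last x s = x
    & walk_weight A x s = max_cycle_mean A ^+ size s].
Proof.
move=> n0 A0; have [lam0|] := leP (max_cycle_mean A) 0.
  have {lam0} lamE : max_cycle_mean A = 0.
    by apply/eqP; rewrite eq_le lam0 max_cycle_mean_ge0.
  exists (Ordinal n0), [:: Ordinal n0]; rewrite n0; split => //.
  apply/eqP; rewrite eq_le closed_walk_le //= lamE expr1.
  by rewrite mulr1 A0.
rewrite ltNge => lam_gt0; have := lexx (max_cycle_mean A).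
rewrite {2}/max_cycle_mean => /bigmax_geP[|[k _]]; first by move/negP: lam_gt0.
have ltk := ltn_ord k.
move=> /bigmax_geP[|[c c_inj]]; first by move/negP: lam_gt0.
rewrite walk_weight_cycle; set s := map _ _; set x := c _ => lam_le.
have sz : size s = k.+1 by rewrite size_map size_enum_ord.
have s_x : last x s = x.
  rewrite (last_nth x) sz /= (nth_map ord0) ?size_enum_ord//.
  by congr (c _); apply: val_inj; rewrite /= nth_enum_ord.
exists x, s; rewrite sz ltk; split => //.
have w0 := walk_weight_ge0 x s A0.
apply/eqP; rewrite eq_le -{1}sz closed_walk_le //=.
have := lerXn2r k.+1 _ _ lam_le; rewrite !nnegrE powR_ge0 max_cycle_mean_ge0.
by move=> /(_ isT isT); rewrite powR_invnK.
Qed.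

Lemma max_cycle_mean_le A b : (0 < n)%N -> nonneg_mx A -> 0 <= b ->
  (forall x s, last x s = x -> walk_weight A x s <= b ^+ size s) ->
  max_cycle_mean A <= b.
Proof.
move=> n0 A0 b0 Hb.
have [x [s [/andP[s0 _] s_x wE]]] := max_cycle_mean_attained n0 A0.
by have := Hb x s s_x; rewrite wE ler_pXn2r ?nnegrE ?max_cycle_mean_ge0.
Qed.

End Walks.

(** * Reduction of the joint spectral radius to the entrywise supremum *)

Section JointSpectralRadius.
Context {R : realType} {n : nat}.
Implicit Types (A B P : 'M[R]_n) (Psi : set 'M[R]_n).

(** In general not a member of [Psi]: different entries may be attained at different matrices. *)
Definition entry_sup Psi : 'M[R]_n :=
  \matrix_(i, j) sup [set A i j | A in Psi].

Lemma compact_entry_max Psi i j : Psi !=set0 -> compact Psi ->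
  exists2 A, Psi A & forall B, Psi B -> B i j <= A i j.
Proof.
move=> Psi0 cPsi.
have [|A PsiA Amax] := @compact_EVT_max _ R (fun A => A i j) Psi Psi0 cPsi.
  exact/continuous_subspaceT/coord_continuous.
by exists A => [|B PsiB]; [rewrite inE in PsiA | apply: Amax; rewrite inE].
Qed.

Lemma entry_sup_attained Psi i j : Psi !=set0 -> compact Psi ->
  exists2 A, Psi A & entry_sup Psi i j = A i j.
Proof.
move=> Psi0 cPsi; have [A PsiA Amax] := compact_entry_max i j Psi0 cPsi.
exists A => //; rewrite mxE; apply/eqP; rewrite eq_le; apply/andP; split.
  by apply: ge_sup => [|_ [B PsiB <-]]; [exists (A i j), A | apply: Amax].
apply: ub_le_sup; last by exists A.
by exists (A i j) => _ [B PsiB <-]; apply: Amax.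
Qed.

Lemma le_entry_sup Psi A i j : compact Psi -> Psi A ->
  A i j <= entry_sup Psi i j.
Proof.
move=> cPsi PsiA; have Psi0 : Psi !=set0 by exists A.
have [B PsiB Bmax] := compact_entry_max i j Psi0 cPsi.
rewrite mxE; apply: ub_le_sup; last by exists A.
by exists (B i j) => _ [C PsiC <-]; apply: Bmax.
Qed.

Lemma max_mulmx_ge0 A B : nonneg_mx (max_mulmx A B).
Proof. by move=> i j; rewrite mxE bigmax_ge_id. Qed.

Lemma max_power0 Psi : max_power Psi 0 = [set 1%:M].
Proof.
apply/seteqP; split => [_ [A _ <-]|_ ->] /=; first by rewrite big_ord0.
by exists (fun=> 0) => [[]//|]; rewrite big_ord0.
Qed.

Lemma max_powerS Psi m :
  max_power Psi m.+1 = [set max_mulmx A P | A in Psi & P in max_power Psi m].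
Proof.
apply/seteqP; split => [_ [A PsiA <-]|_ [A PsiA [_ [B PsiB <-] <-]]].
  rewrite big_ord_recl; exists (A ord0) => //.
  by exists (\big[max_mulmx/1%:M]_(j < m) A (lift ord0 j)) => //;
    exists (fun j => A (lift ord0 j)).
exists (fun i => if unlift ord0 i is Some j then B j else A) => [i|].
  by case: unliftP => [j _|_].
rewrite big_ord_recl unlift_none; congr max_mulmx.
by apply: eq_bigr => i _; rewrite liftK.
Qed.

Lemma max_power_ge0 Psi m P : max_power Psi m P -> nonneg_mx P.
Proof.
case: m => [|m].
  by rewrite max_power0 => -> i j; rewrite mxE ler0n.
by rewrite max_powerS => -[A _ [B _ <-]]; apply: max_mulmx_ge0.
Qed.

Variable Psi : set 'M[R]_n.
Hypotheses (n_gt0 : (0 < n)%N) (Psi0 : Psi !=set0) (cPsi : compact Psi)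
  (Psi_ge0 : Psi `<=` nonneg_mx).
Let S := entry_sup Psi.
Let lam := max_cycle_mean S.

Lemma entry_sup_ge0 : nonneg_mx S.
Proof.
move=> i j; have [A /Psi_ge0 A0 ->] := entry_sup_attained i j Psi0 cPsi.
exact: A0.
Qed.

(** Expanding the maxima picks one intermediate index per factor, and each factor lies below [S].
    Positivity rules out the default 0 of the maximum and the off-diagonal zeros of the identity. *)
Lemma max_power_walk m P i j : max_power Psi m P -> 0 < P i j ->
  exists s, [/\ size s = m, last i s = j & P i j <= walk_weight S i s].
Proof.
elim: m P i => [|m IHm] P i.
  rewrite max_power0 => ->; rewrite mxE ltr0n lt0b => /eqP ->.
  by exists [::]; rewrite eqxx.
rewrite max_powerS => -[A PsiA [B PsiB <-]] P_gt0.
have := lexx (max_mulmx A B i j); rewrite {2}mxE => /bigmax_geP[|[k _ Pk]].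
  by rewrite leNgt P_gt0.
have A0 := Psi_ge0 PsiA i k; have B0 := max_power_ge0 PsiB k j.
have Bkj : 0 < B k j.
  rewrite lt_neqAle B0 andbT; apply: contraTneq (lt_le_trans P_gt0 Pk) => <-.
  by rewrite mulr0 ltxx.
have [s [sz s_j Bs]] := IHm _ _ PsiB Bkj.
exists (k :: s); rewrite /= sz s_j; split => //.
by apply: le_trans Pk _; rewrite ler_pM// le_entry_sup.
Qed.

(** Each edge of a walk in [P] unfolds into [m] edges in [S]. *)
Lemma max_power_walk_weight m P x t : max_power Psi m P ->
  0 < walk_weight P x t ->
  exists s, [/\ size s = (m * size t)%N, last x s = last x t
    & walk_weight P x t <= walk_weight S x s].
Proof.
move=> PsiP; have P0 := max_power_ge0 PsiP; elim: t x => [|y t IHt] x /=.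
  by move=> _; exists [::]; rewrite muln0.
move=> w_gt0; have t0 := walk_weight_ge0 y t P0.
have Pxy : 0 < P x y.
  by rewrite lt_neqAle P0 andbT; apply: contraTneq w_gt0 => <-; rewrite mul0r ltxx.
have t_gt0 : 0 < walk_weight P y t.
  by rewrite lt_neqAle t0 andbT; apply: contraTneq w_gt0 => <-; rewrite mulr0 ltxx.
have [s1 [sz1 l1 w1]] := max_power_walk PsiP Pxy.
have [s2 [sz2 l2 w2]] := IHt _ t_gt0.
exists (s1 ++ s2); rewrite size_cat sz1 sz2 mulnS last_cat l1 l2; split => //.
by rewrite walk_weight_cat l1 ler_pM.
Qed.

Lemma max_power_cycle_mean_le m P : max_power Psi m P ->
  max_cycle_mean P <= lam ^+ m.
Proof.
move=> PsiP; have P0 := max_power_ge0 PsiP.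
have lam0 : 0 <= lam by exact: max_cycle_mean_ge0.
apply: max_cycle_mean_le => // [|x t t_x]; first exact: exprn_ge0.
have [w0|w0] := leP (walk_weight P x t) 0.
  by apply: le_trans w0 _; rewrite !exprn_ge0.
have [s [sz s_x /le_trans->//]] := max_power_walk_weight PsiP w0.
rewrite -exprM -sz; apply: closed_walk_le; first exact: entry_sup_ge0.
by rewrite s_x.
Qed.

(** Here the factors are chosen independently: each step uses a matrix of [Psi] attaining the
    required entry of [S]. *)
Lemma walk_in_max_power x s : exists2 P, max_power Psi (size s) P &
  walk_weight S x s <= P x (last x s).
Proof.
elim: s x => [|y s IHs] x /=.
  by exists 1%:M; rewrite ?max_power0// mxE eqxx.
have [P PsiP wP] := IHs y.
have [A PsiA AE] := entry_sup_attained x y Psi0 cPsi.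
exists (max_mulmx A P); first by rewrite max_powerS; exists A => //; exists P.
rewrite [leRHS]mxE; apply: (bigmax_sup y) => //.
by rewrite AE ler_wpM2l// Psi_ge0.
Qed.

Lemma sup_cycle_mean_ub m :
  ubound [set max_cycle_mean P | P in max_power Psi m] (lam ^+ m).
Proof. by move=> _ [P /max_power_cycle_mean_le + <-]. Qed.

Lemma sup_cycle_mean_itv m :
  0 <= sup [set max_cycle_mean P | P in max_power Psi m] <= lam ^+ m.
Proof.
have [A PsiA] := Psi0; pose P := \big[max_mulmx/1%:M]_(j < m) A.
have PsiP : max_power Psi m P by exists (fun=> A).
apply/andP; split; last first.
  by apply: ge_sup (@sup_cycle_mean_ub m); exists (max_cycle_mean P), P.
apply: le_trans (max_cycle_mean_ge0 P) _.
by apply: ub_le_sup; [exists (lam ^+ m); exact: sup_cycle_mean_ub | exists P].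
Qed.

(** A diagonal entry of a product is the weight of a loop, hence at most its cycle mean. *)
Lemma closed_walk_le_sup x s : last x s = x ->
  walk_weight S x s <=
  sup [set max_cycle_mean P | P in max_power Psi (size s)].
Proof.
move=> s_x; have [P PsiP wP] := walk_in_max_power x s.
apply: le_trans wP _; rewrite s_x.
apply: (@le_trans _ _ (max_cycle_mean P)).
  have := @closed_walk_le _ _ P x [:: x] (max_power_ge0 PsiP) erefl.
  by rewrite /= mulr1 expr1.
by apply: ub_le_sup; [exists (lam ^+ size s); exact: sup_cycle_mean_ub | exists P].
Qed.

Lemma closed_walk_iter x s N : last x s = x ->
  exists t, [/\ size t = (size s * N)%N, last x t = x
    & walk_weight S x t = walk_weight S x s ^+ N].
Proof.
move=> s_x; elim: N => [|N [t [szt t_x wt]]].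
  by exists [::]; rewrite muln0 expr0.
exists (s ++ t); rewrite size_cat last_cat s_x t_x szt mulnS; split => //.
by rewrite walk_weight_cat s_x wt exprS.
Qed.

(** For positive [m] the [m]-th term is at most [lam], with equality at multiples of the length of
    an optimal cycle. *)
Lemma max_jsr_entry_sup : max_jsr Psi = max_cycle_mean (entry_sup Psi).
Proof.
pose u (m : nat) :=
  sup [set max_cycle_mean A | A in max_power Psi m] `^ m%:R^-1.
have lam0 : 0 <= lam by exact: max_cycle_mean_ge0.
have powK m : (0 < m)%N -> (lam ^+ m) `^ m%:R^-1 = lam.
  by move=> m0; rewrite -powR_mulrn// -powRrM mulfV ?powRr1// pnatr_eq0 -lt0n.
have [x [s [/andP[s0 _] s_x wE]]] := max_cycle_mean_attained n_gt0 entry_sup_ge0.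
have u_le m : (0 < m)%N -> u m <= lam.
  move=> m0; rewrite -[leRHS](powK m)//.
  have /andP[sup_ge0 sup_le] := sup_cycle_mean_itv m.
  by apply: ge0_ler_powR => //; rewrite ?nnegrE ?exprn_ge0.
have u_ge N : (0 < N)%N -> lam <= u (size s * N)%N.
  move=> N0; rewrite -[leLHS](powK (size s * N)%N) ?muln_gt0 ?s0//.
  have [t [szt t_x wt]] := closed_walk_iter N s_x.
  have := closed_walk_le_sup t_x; rewrite szt wt wE -exprM => le_sup.
  by apply: ge0_ler_powR => //; rewrite ?nnegrE ?(le_trans _ le_sup) ?exprn_ge0.
(* The tail suprema are constant from index 1 on; index 0 is excluded because its exponent is
   [0^-1 = 0] and its term is 1. *)
apply: norm_lim_near_cst; near=> N.
have N0 : (0 < N)%N by near: N; exact: nbhs_infty_gt.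
have u_ub : ubound (sdrop u N) lam.
  by move=> _ [m /= le_Nm <-]; apply: u_le; apply: leq_trans le_Nm.
apply/eqP; rewrite eq_le; apply/andP; split.
  by apply: ge_sup u_ub; exists (u N), N => /=.
apply: le_trans (u_ge N N0) _; apply: ub_le_sup; first by exists lam.
by exists (size s * N)%N => //=; rewrite leq_pmull.
Unshelve. all: by end_near. Qed.

End JointSpectralRadius.

(** * Irreducibility forces a positive cycle *)

Section Irreducibility.
Context {R : realType} {n : nat}.
Implicit Types (A : 'M[R]_n) (Psi : set 'M[R]_n).

Lemma walk_weight_gt0 A x s :
  path (fun i j => 0 < A i j) x s -> 0 < walk_weight A x s.
Proof.
by elim: s x => [|y s IHs] x //= /andP[Axy /IHs]; apply: mulr_gt0.
Qed.

(** Otherwise the vertices reachable from [i] form a nonempty proper set that no positive entry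
    leaves. *)
Lemma irreducible_connect A i j : nonneg_mx A -> irreducible_mx A ->
  connect (fun i j => 0 < A i j) i j.
Proof.
move=> A0 irrA; apply/negPn/negP => Nij; apply: irrA.
exists [set k | connect (fun i j => 0 < A i j) i k]%SET; split.
- by apply/set0Pn; exists i; rewrite inE connect0.
- by apply/properP; split; [exact: finset.subsetT | exists j; rewrite inE].
move=> k l; rewrite !inE => ik Nil; apply/eqP; rewrite eq_le A0 andbT leNgt.
by apply: contra Nil => Akl; apply: connect_trans ik (connect1 Akl).
Qed.

(** Positive walks between two distinct vertices, there and back, close up. A second vertex is
    essential: the zero matrix of size 1 is irreducible. *)
Lemma irreducible_max_cycle_mean_gt0 A : (1 < n)%N -> nonneg_mx A ->
  irreducible_mx A -> 0 < max_cycle_mean A.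
Proof.
move=> n1 A0 irrA; pose i := Ordinal (ltnW n1); pose j := Ordinal n1.
have /connectP[p pp pj] := irreducible_connect i j A0 irrA.
have /connectP[q qq qi] := irreducible_connect j i A0 irrA.
have w_gt0 : 0 < walk_weight A i (p ++ q).
  by apply: walk_weight_gt0; rewrite cat_path pp -pj.
have pq_i : last i (p ++ q) = i by rewrite last_cat -pj -qi.
rewrite lt_neqAle max_cycle_mean_ge0 andbT eq_sym; apply/eqP => lam0.
have := lt_le_trans w_gt0 (closed_walk_le A0 pq_i).
(* [p] is nonempty because [i] and [j] differ, so the power of 0 is 0 and not 1. *)
case: p pj {pp w_gt0 pq_i} => [/(congr1 val)//|k p _].
by rewrite lam0 expr0n /= ltxx.
Qed.

(** A path from [I] to its complement must leave [I] at some factor, whose entry there vanishes with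
    that of [entry_sup Psi]. *)
Lemma max_power_block0 Psi (I : {set 'I_n}) m P : compact Psi ->
  Psi `<=` nonneg_mx ->
  (forall i j, i \in I -> j \notin I -> entry_sup Psi i j = 0) ->
  max_power Psi m P -> forall i j, i \in I -> j \notin I -> P i j = 0.
Proof.
move=> cPsi Psi_ge0 S0; elim: m P => [|m IHm] P.
  rewrite max_power0 => -> i j iI jI; rewrite mxE.
  by case: eqP jI => // <-; rewrite iI.
rewrite max_powerS => -[A PsiA [B PsiB <-]] i j iI jI; rewrite mxE.
apply: bigmax_eq_id => k _.
have [kI|kI] := boolP (k \in I); first by rewrite (IHm _ PsiB)// mulr0.
suff -> : A i k = 0 by rewrite mul0r.
apply/eqP; rewrite eq_le (Psi_ge0 _ PsiA) andbT -(S0 i k)//.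
exact: le_entry_sup.
Qed.

Lemma entry_sup_irreducible Psi : compact Psi -> Psi `<=` nonneg_mx ->
  irreducible_semigroup Psi -> irreducible_mx (entry_sup Psi).
Proof.
move=> cPsi Psi_ge0 [m [A [[k [a [x [Mx _ _ ->]]]] irrA]]] [I [I0 IT SI]].
apply: irrA; exists I; split=> // i j iI jI.
apply: (big_ind (fun B : 'M[R]_n => B i j = 0)) => [|B C B0 C0|l _].
- by rewrite mxE.
- by rewrite mxE B0 C0 maxxx.
- by rewrite mxE (max_power_block0 cPsi Psi_ge0 SI (Mx l))// mulr0.
Qed.

End Irreducibility.

(** * Perturbation of the cycle mean of a single matrix *)

Section Lipschitz.
Context {R : realType} {n : nat}.
Implicit Types (A S T : 'M[R]_n).

Lemma walk_weight_ub A M x s : nonneg_mx A -> (forall i j, A i j <= M) ->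
  walk_weight A x s <= M ^+ size s.
Proof.
move=> A0 AM; elim: s x => [|y s IHs] x //=.
by rewrite exprS ler_pM ?walk_weight_ge0.
Qed.

Lemma walk_weight_lb A b x s : 0 <= b ->
  path (fun i j => b <= A i j) x s -> b ^+ size s <= walk_weight A x s.
Proof.
move=> b0; elim: s x => [|y s IHs] x //= /andP[bA /IHs bs].
by rewrite exprS ler_pM ?exprn_ge0.
Qed.

(** The other edges contribute at most [M] each, so every edge is at least [b / M ^+ (size s - 1)];
    the multiplied form avoids division and truncated subtraction. *)
Lemma walk_weight_edges A M b x s : nonneg_mx A -> 0 < M ->
  (forall i j, A i j <= M) -> b <= walk_weight A x s ->
  path (fun i j => b * M <= A i j * M ^+ size s) x s.
Proof.
move=> A0 M0 AM; elim: s x b => [//|y s IHs] x b /= bw.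
have w0 := walk_weight_ge0 y s A0; apply/andP; split.
  rewrite exprS (mulrC M) mulrA ler_pM2r//; apply: le_trans bw _.
  by rewrite ler_wpM2l// walk_weight_ub.
have /IHs : b / M <= walk_weight A y s.
  by rewrite ler_pdivrMr// mulrC; apply: le_trans bw _; rewrite ler_wpM2r.
apply: sub_path => i j; rewrite divfK ?gt_eqF// => bA.
by rewrite exprS mulrCA mulrC ler_pM2l.
Qed.

(** As [c / M <= 1], replacing the length by [n] in the exponent gives a bound independent of the
    walk. *)
Lemma walk_edges_ge S M c x s : nonneg_mx S -> (forall i j, S i j <= M) ->
  0 < c <= M -> (size s <= n)%N -> c ^+ size s <= walk_weight S x s ->
  path (fun i j => M * (c / M) ^+ n <= S i j) x s.
Proof.
move=> S0 SM /andP[c0 cM] sn cw; have M0 := lt_le_trans c0 cM.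
apply: sub_path (walk_weight_edges S0 M0 SM cw) => i j.
rewrite -ler_pdivrMr ?exprn_gt0// mulrAC -expr_div_n mulrC; apply: le_trans.
rewrite ler_pM2l//; apply: ler_wiXn2l => //; first by rewrite divr_ge0 ?ltW.
by rewrite ler_pdivrMr// mul1r.
Qed.

Lemma walk_weight_scale S T q x s : nonneg_mx S -> 0 <= q ->
  path (fun i j => q * S i j <= T i j) x s ->
  q ^+ size s * walk_weight S x s <= walk_weight T x s.
Proof.
move=> S0 q0; elim: s x => [|y s IHs] x /=; first by rewrite expr0 mul1r.
move=> /andP[qS /IHs wle]; rewrite exprS mulrACA.
by rewrite ler_pM// mulr_ge0 ?exprn_ge0 ?walk_weight_ge0.
Qed.

Lemma max_cycle_mean_ub S M : (0 < n)%N -> nonneg_mx S -> 0 <= M ->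
  (forall i j, S i j <= M) -> max_cycle_mean S <= M.
Proof.
by move=> n0 S0 M0 SM; apply: max_cycle_mean_le => // x s _; apply: walk_weight_ub.
Qed.

(** The constant depends only on [n], [M] and [c], so it can serve a whole neighbourhood. *)
Lemma max_cycle_mean_lipschitz S T M c d : (0 < n)%N ->
  nonneg_mx S -> nonneg_mx T -> (forall i j, S i j <= M) ->
  0 < c <= max_cycle_mean S -> 0 <= d -> (forall i j, S i j <= T i j + d) ->
  max_cycle_mean S <= max_cycle_mean T + (M / c) ^+ n * d.
Proof.
move=> n0 S0 T0 SM /andP[c0 c_le] d0 ST.
have M_ge0 : 0 <= M by apply: le_trans (SM (Ordinal n0) (Ordinal n0)).
have lamM := max_cycle_mean_ub n0 S0 M_ge0 SM.
have cM := le_trans c_le lamM; have M0 := lt_le_trans c0 cM.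
set lam := max_cycle_mean S in c_le lamM *.
have lam0 : 0 < lam by exact: lt_le_trans c_le.
have [x [s [/andP[s0 sn] s_x wE]]] := max_cycle_mean_attained n0 S0.
pose e := M * (c / M) ^+ n.
have e0 : 0 < e by rewrite mulr_gt0// exprn_gt0// divr_gt0.
have -> : (M / c) ^+ n = M / e.
  by rewrite /e invfM mulrA mulfV ?gt_eqF// mul1r -exprVn invf_div.
have edges : path (fun i j => e <= S i j) x s.
  apply: walk_edges_ge; rewrite ?c0//.
  by rewrite wE; apply: lerXn2r c_le; rewrite nnegrE ltW.
(* For [d > e] the term [M / e * d] alone exceeds [M]; otherwise the factor [1 - d / e] is
   nonnegative. *)
have [ed|de] := ltP e d.
  apply: le_trans lamM _; rewrite -[leLHS]add0r lerD ?max_cycle_mean_ge0//.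
  by rewrite -mulrA ler_peMr// mulrC ler_pdivlMr// mul1r ltW.
have q0 : 0 <= 1 - d / e by rewrite subr_ge0 ler_pdivrMr// mul1r.
(* Since [e <= S i j], the loss [d] is at most the fraction [d / e] of the entry. *)
have : path (fun i j => (1 - d / e) * S i j <= T i j) x s.
  apply: sub_path edges => i j eS; rewrite mulrBl mul1r lerBlDr.
  apply: le_trans (ST i j) _; rewrite lerD2l mulrAC ler_pdivlMr//.
  by rewrite ler_wpM2l.
move=> /(walk_weight_scale S0 q0) wle.
have : ((1 - d / e) * lam) ^+ size s <= max_cycle_mean T ^+ size s.
  by rewrite exprMn -wE; apply: le_trans wle _; apply: closed_walk_le.
rewrite ler_pXn2r ?nnegrE ?max_cycle_mean_ge0 ?(mulr_ge0 q0 (ltW lam0))//.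
rewrite mulrBl mul1r lerBlDr => /le_trans; apply; rewrite lerD2l.
by rewrite mulrC -mulrA (mulrC e^-1) ler_wpM2r// divr_ge0// ltW.
Qed.

(** Supplies the positive lower bound near [S] that the Lipschitz estimate requires; one [c] serves
    as tolerance and as bound. *)
Lemma max_cycle_mean_lower_bound S : (0 < n)%N -> nonneg_mx S ->
  0 < max_cycle_mean S -> exists2 c, 0 < c & forall T, nonneg_mx T ->
  (forall i j, S i j <= T i j + c) -> c <= max_cycle_mean T.
Proof.
move=> n0 S0 lam0.
have [x [s [/andP[s0 sn] s_x wE]]] := max_cycle_mean_attained n0 S0.
pose M := \sum_i \sum_j S i j.
have SM i j : S i j <= M.
  rewrite /M (bigD1 i)//= (bigD1 j)//= -addrA lerDl addr_ge0//.
    by apply: sumr_ge0 => k _; apply: S0.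
  by apply: sumr_ge0 => k _; apply: sumr_ge0 => l _; apply: S0.
have M_ge0 : 0 <= M by apply: le_trans (SM (Ordinal n0) (Ordinal n0)).
have lamM := max_cycle_mean_ub n0 S0 M_ge0 SM.
have M0 := lt_le_trans lam0 lamM.
have := walk_edges_ge (x := x) S0 SM (introT andP (conj lam0 lamM)) sn.
rewrite wE lexx => /(_ isT) edges.
set e := M * _ in edges.
have e0 : 0 < e by rewrite mulr_gt0// exprn_gt0// divr_gt0.
(* Edges of weight at least [e] keep at least half of it after a loss of [e / 2]. *)
exists (e / 2) => [|T T0 ST]; first by rewrite divr_gt0.
have : (e / 2) ^+ size s <= max_cycle_mean T ^+ size s.
  apply: le_trans (closed_walk_le T0 s_x).
  apply: walk_weight_lb; first by rewrite divr_ge0 ?ltW.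
  by apply: sub_path edges => i j eS; have := ST i j; lra.
by rewrite ler_pXn2r ?nnegrE ?max_cycle_mean_ge0 // divr_ge0// ltW.
Qed.

End Lipschitz.

(** * Hausdorff distance controls the entrywise supremum *)

Section Hausdorff.
Context {R : realType} {n : nat}.
Implicit Types (A B : 'M[R]_n) (Psi Phi : set 'M[R]_n).

Lemma entry_le_mx_norm (p q : nat) (M : 'M[R]_(p, q)) i j : `|M i j| <= `|M|.
Proof.
rewrite [leRHS]/Num.norm /= mx_normrE.
by apply: (le_bigmax_cond _ (fun ij : 'I_p * 'I_q => `|M ij.1 ij.2|) (j := (i, j))).
Qed.

Lemma mx_norm_le (p q : nat) (M : 'M[R]_(p, q)) b : 0 <= b ->
  (forall i j, `|M i j| <= b) -> `|M| <= b.
Proof.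
move=> b0 Mb; rewrite [leLHS]/Num.norm /= mx_normrE.
by apply: bigmax_le => // ij _; apply: Mb.
Qed.

(** A crude bound by the largest entry, making the supremum in [induced_norm] finite. *)
Lemma induced_norm_ub A :
  ubound [set `|A *m x| | x in [set x : 'cV[R]_n | `|x| <= 1]] (n%:R * `|A|).
Proof.
move=> _ [x /= x1 <-]; apply: mx_norm_le => [|i j]; first by rewrite mulr_ge0.
rewrite mxE (le_trans (ler_norm_sum _ _ _))//.
rewrite -[X in X%:R * _]card_ord mulr_natl -sumr_const ler_sum// => k _.
rewrite normrM -[leRHS]mulr1 ler_pM ?entry_le_mx_norm//.
by rewrite (le_trans (entry_le_mx_norm _ _ _)).
Qed.

Lemma induced_norm_le A : induced_norm A <= n%:R * `|A|.
Proof.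
by apply: ge_sup (@induced_norm_ub A); exists `|A *m (0 : 'cV[R]_n)|, 0; rewrite //= normr0.
Qed.

Lemma entry_le_induced_norm A i j : `|A i j| <= induced_norm A.
Proof.
pose x : 'cV[R]_n := delta_mx j 0.
have -> : A i j = (A *m x) i 0 by rewrite -colE mxE.
apply: le_trans (entry_le_mx_norm _ _ _) _.
apply: ub_le_sup; first by exists (n%:R * `|A|); apply: induced_norm_ub.
exists x => //=; apply: mx_norm_le => // k l.
by rewrite mxE normr_nat lern1 leq_b1.
Qed.

Lemma induced_norm_ge0 A : 0 <= induced_norm A.
Proof.
have n0 : `|A *m 0 : 'cV[R]_n| = 0 by rewrite mulmx0 normr0.
rewrite -n0; apply: ub_le_sup; first by exists (n%:R * `|A|); apply: induced_norm_ub.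
by exists 0; rewrite //= normr0.
Qed.

Lemma set_dist_has_lbound A Phi :
  has_lbound [set induced_norm (A - B) | B in Phi].
Proof. by exists 0 => _ [B _ <-]; apply: induced_norm_ge0. Qed.

(** A fixed member of [Phi] and the bounded norms on [Psi] bound all distances, so the supremum in
    [hausdorff_dist] is genuine. *)
Lemma set_dist_has_ubound Psi Phi : Psi !=set0 -> compact Psi -> Phi !=set0 ->
  has_ubound [set set_dist A Phi | A in Psi].
Proof.
move=> Psi0 cPsi [B PhiB].
have [|C PsiC Cmax] := @compact_EVT_max _ R (fun A => `|A|) Psi Psi0 cPsi.
  exact/continuous_subspaceT/norm_continuous.
exists (n%:R * (`|C| + `|B|)) => _ [A PsiA <-].
apply: (@le_trans _ _ (induced_norm (A - B))).
  by apply: ge_inf; [exact: set_dist_has_lbound | exists B].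
apply: le_trans (induced_norm_le _) _; rewrite ler_wpM2l//.
by apply: le_trans (ler_normB _ _) _; rewrite lerD2r Cmax// inE.
Qed.

Lemma hausdorff_distC Psi Phi : hausdorff_dist Psi Phi = hausdorff_dist Phi Psi.
Proof. exact: maxC. Qed.

Lemma set_dist_le_hausdorff Psi Phi A : Psi !=set0 -> compact Psi ->
  Phi !=set0 -> Psi A -> set_dist A Phi <= hausdorff_dist Psi Phi.
Proof.
move=> Psi0 cPsi Phi0 PsiA; rewrite le_max; apply/orP; left.
by apply: ub_le_sup; [exact: set_dist_has_ubound | exists A].
Qed.

Lemma set_dist_ge0 A Phi : Phi !=set0 -> 0 <= set_dist A Phi.
Proof.
move=> [B PhiB]; apply: lb_le_inf; first by exists (induced_norm (A - B)), B.
by move=> _ [C _ <-]; apply: induced_norm_ge0.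
Qed.

Lemma hausdorff_dist_ge0 Psi Phi : Psi !=set0 -> compact Psi -> Phi !=set0 ->
  0 <= hausdorff_dist Psi Phi.
Proof.
move=> Psi0 cPsi Phi0; have [A PsiA] := Psi0.
exact: le_trans (set_dist_ge0 A Phi0) (set_dist_le_hausdorff _ _ _ _).
Qed.

(** A matrix of [Psi] attaining the entry has a close neighbour in [Phi], whose entry lies below
    that of [entry_sup Phi]. *)
Lemma entry_sup_hausdorff Psi Phi i j : Psi !=set0 -> compact Psi ->
  Phi !=set0 -> compact Phi ->
  entry_sup Psi i j <= entry_sup Phi i j + hausdorff_dist Psi Phi.
Proof.
move=> Psi0 cPsi Phi0 cPhi.
have [A PsiA ->] := entry_sup_attained i j Psi0 cPsi.
(* An arbitrary slack [e] replaces attainment of the infimum. *)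
apply/ler_addgt0Pr => e e0.
have [|_ [B PhiB <-] ABe] :=
    @inf_adherent _ [set induced_norm (A - B) | B in Phi] _ e0.
  split; last exact: set_dist_has_lbound.
  by have [B PhiB] := Phi0; exists (induced_norm (A - B)), B.
have AB : A i j - B i j <= induced_norm (A - B).
  apply: le_trans (entry_le_induced_norm _ i j).
  by rewrite !mxE ler_norm.
have BS := le_entry_sup i j cPhi PhiB.
have := set_dist_le_hausdorff Psi0 cPsi Phi0 PsiA.
move: ABe; rewrite -/(set_dist A Phi); lra.
Qed.

End Hausdorff.

(** * Dimension one and the final estimate *)

Lemma max_cycle_mean1 (R : realType) (A : 'M[R]_(1, 1)) : nonneg_mx A ->
  max_cycle_mean A = A 0 0.
Proof.
move=> A0; have [x [s [/andP[s0 s1] _]]] := @max_cycle_mean_attained R 1 A isT A0.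
case: s s0 s1 => [//|y [|//]] _ _ /=.
by rewrite !ord1 mulr1 expr1.
Qed.

Lemma max_cycle_mean_entry_sup_gt0 (R : realType) (n : nat)
    (Psi : set 'M[R]_n) : (1 < n)%N -> compact_irreducible Psi ->
  0 < max_cycle_mean (entry_sup Psi).
Proof.
move=> n1 [Psi0 cPsi Psi_ge0 irrPsi].
apply: irreducible_max_cycle_mean_gt0 => //; first exact: entry_sup_ge0.
exact: entry_sup_irreducible.
Qed.

Theorem theorem4p10 (R : realType) (n : nat) (n_gt0 : (0 < n)%N) :
  locally_lipschitz_on (@compact_irreducible R n) hausdorff_dist max_jsr.
Proof.
move=> X [X0 cX X_ge0 irrX].
(* A one-sided bound suffices, as [Y] and [Z] may be exchanged. *)
suff [r [L [r0 L0 lipP]]] : exists r L : R, [/\ 0 < r, 0 <= L &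
    forall Y Z, compact_irreducible Y -> compact_irreducible Z ->
    hausdorff_dist X Y < r -> hausdorff_dist X Z < r ->
    max_cycle_mean (entry_sup Y) <=
      max_cycle_mean (entry_sup Z) + L * hausdorff_dist Y Z].
  exists r, L; split=> // Y Z HY HZ XY XZ.
  have [Y0 cY Y_ge0 _] := HY; have [Z0 cZ Z_ge0 _] := HZ.
  rewrite !max_jsr_entry_sup// ler_norml.
  have := lipP _ _ HY HZ XY XZ; have := lipP _ _ HZ HY XZ XY.
  by rewrite (hausdorff_distC Z Y) => *; apply/andP; split; lra.
(* For [n = 1] the cycle mean may vanish, but it is the entry itself, so the constant 1 works with
   any radius. *)
have [n1|n1] := leqP n 1.
  have nE : n = 1%N by apply/eqP; rewrite eqn_leq n1.
  subst n; exists 1, 1; split=> // Y Z [Y0 cY Y_ge0 _] [Z0 cZ Z_ge0 _] _ _.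
  rewrite !max_cycle_mean1 ?mul1r; try exact: entry_sup_ge0.
  exact: entry_sup_hausdorff.
have SX0 := entry_sup_ge0 X0 cX X_ge0.
have lam0 : 0 < max_cycle_mean (entry_sup X).
  exact: max_cycle_mean_entry_sup_gt0.
have [c c0 lbP] := max_cycle_mean_lower_bound n_gt0 SX0 lam0.
(* Bounds the entries of [entry_sup Y] for all [Y] within distance [c] of [X]. *)
pose M := `|entry_sup X| + c.
exists c, ((M / c) ^+ n); split=> // [|Y Z [Y0 cY Y_ge0 _] [Z0 cZ Z_ge0 _] XY XZ].
  by rewrite exprn_ge0// divr_ge0 ?addr_ge0// ltW.
apply: max_cycle_mean_lipschitz => //; try exact: entry_sup_ge0.
- move=> i j; apply: le_trans (entry_sup_hausdorff i j Y0 cY X0 cX) _.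
  rewrite hausdorff_distC lerD ?(ltW XY)//.
  by apply: le_trans (ler_norm _) (entry_le_mx_norm _ _ _).
- rewrite c0 lbP//; first exact: entry_sup_ge0.
  move=> i j; apply: le_trans (entry_sup_hausdorff i j X0 cX Y0 cY) _.
  by rewrite lerD2l ltW.
- exact: hausdorff_dist_ge0.
- by move=> i j; apply: entry_sup_hausdorff.
Qed.
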